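(* Let $\Lambda$ be a quantum operation and $\Gamma$ the einselection operation on a Hilbert space $\mathcal{H}$. The quantumness $W(\Lambda)=\sup_\rho S\big(\Lambda\circ\Gamma(\rho)\,\|\,\Gamma\circ\Lambda(\rho)\big)$ of $\Lambda$ is a sum of two contributions: $$W(\Lambda)=\sup_\rho\Big(S\big(\Gamma\circ\Lambda\circ\Gamma(\rho)\,\|\,\Gamma\circ\Lambda(\rho)\big)+S\big(\Lambda\circ\Gamma(\rho)\,\|\,\Gamma\circ\Lambda\circ\Gamma(\rho)\big)\Big),$$ where the suprema are over all quantum states $\rho$ on $\mathcal{H}$.
   Context: $\mathcal{H}$ is a finite-dimensional Hilbert space; states are density operators on it. A quantum operation $\Lambda:\mathcal{B}(\mathcal{H})\to\mathcal{B}(\mathcal{H})$ is a completely positive trace-preserving linear map. The relative entropy is $S(\rho\|\sigma)=\mathrm{Tr}[\rho(\log_2\rho-\log_2\sigma)]$, equal to $+\infty$ if the support of $\rho$ is not contained in the support of $\sigma$. The einselection operation is $\Gamma(\rho)=\sum_\alpha\Pi_\alpha\rho\Pi_\alpha$ with $\Pi_\alpha$ mutually orthogonal projectors, $\sum_\alpha\Pi_\alpha=\mathbf{1}$; here $\Pi_\alpha=|\alpha\rangle\langle\alpha|$ for a fixed orthonormal basis of pointer states or, when $\mathcal{H}$ is bipartite, $\Gamma=\Gamma_1\otimes\Gamma_2$ with each $\Gamma_k$ such a dephasing in a local orthonormal basis, one of the $\Gamma_k$ possibly replaced by the identity map. *)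

(* Defs.v *)
From mathcomp Require Import all_boot all_order all_algebra.
From mathcomp Require Import complex mxtens spectral sesquilinear.
From mathcomp Require Import all_classical all_reals all_analysis.

Set Implicit Arguments.
Unset Strict Implicit.
Unset Printing Implicit Defensive.

Import Order.TTheory GRing.Theory Num.Theory.
Local Open Scope classical_set_scope.
Local Open Scope ring_scope.
Local Open Scope complex_scope.
Local Open Scope sesquilinear_scope.

(* A Hilbert space of dimension n is C^n with column vectors as kets, so that
   <u|v> is [u ^t* *m v]; a bipartite space of local dimensions n1, n2 is
   C^(n1 * n2), with [A *t B] the Kronecker product of operators. *)

Section Operators.
Variable R : realType.
Local Notation C := R[i].

(* In C, [0 <= z] says that z is real and nonnegative; self-adjointness of A
   follows by polarization. *)
Definition psd n (A : 'M[C]_n) : Prop :=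
  forall v : 'cV[C]_n, 0 <= (v ^t* *m A *m v) 0 0.

Definition density n : set 'M[C]_n := [set rho | psd rho /\ \tr rho = 1].

(* The tensor product of two linear maps on operators, i.e. the linear map
   determined by A *t B |-> F A *t G B. *)
Definition tensor_op n1 n2 (F : 'M[C]_n1 -> 'M[C]_n1) (G : 'M[C]_n2 -> 'M[C]_n2)
    (X : 'M[C]_(n1 * n2)) : 'M[C]_(n1 * n2) :=
  \sum_(i < n1) \sum_(j < n1) \sum_(k < n2) \sum_(l < n2)
    X (mxtens_index (i, k)) (mxtens_index (j, l)) *:
      (F (delta_mx i j) *t G (delta_mx k l)).

Definition completely_positive n (L : 'M[C]_n -> 'M[C]_n) : Prop :=
  forall (k : nat) (X : 'M[C]_(k * n)), psd X -> psd (tensor_op id L X).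

Definition trace_preserving n (L : 'M[C]_n -> 'M[C]_n) : Prop :=
  forall X, \tr (L X) = \tr X.

Definition quantum_operation n (L : {linear 'M[C]_n -> 'M[C]_n}) : Prop :=
  completely_positive L /\ trace_preserving L.

(* n orthonormal vectors of C^n automatically form a basis. *)
Definition orthonormal_basis n (e : 'I_n -> 'cV[C]_n) : Prop :=
  forall i j, (e i) ^t* *m e j = ((i == j)%:R)%:M.

Definition pinching (I : finType) n (P : I -> 'M[C]_n) (rho : 'M[C]_n) :
  'M[C]_n := \sum_(a in I) P a *m rho *m P a.

Definition dephasing n (e : 'I_n -> 'cV[C]_n) : 'M[C]_n -> 'M[C]_n :=
  pinching (fun a => e a *m (e a) ^t*).

Inductive einselection : forall n : nat, ('M[C]_n -> 'M[C]_n) -> Prop :=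
| Einselection n (e : 'I_n -> 'cV[C]_n) :
    orthonormal_basis e -> einselection (dephasing e)
| Einselection12 n1 n2 (e1 : 'I_n1 -> 'cV[C]_n1) (e2 : 'I_n2 -> 'cV[C]_n2) :
    orthonormal_basis e1 -> orthonormal_basis e2 ->
    einselection (tensor_op (dephasing e1) (dephasing e2))
| Einselection1 n1 n2 (e1 : 'I_n1 -> 'cV[C]_n1) :
    orthonormal_basis e1 ->
    einselection (tensor_op (dephasing e1) (@id 'M[C]_n2))
| Einselection2 n1 n2 (e2 : 'I_n2 -> 'cV[C]_n2) :
    orthonormal_basis e2 ->
    einselection (tensor_op (@id 'M[C]_n1) (dephasing e2)).

(* The orthogonal complement of the kernel. *)
Definition op_support n (A : 'M[C]_n) : set 'cV[C]_n :=
  [set v | forall w : 'cV[C]_n, A *m w = 0 -> w ^t* *m v = 0].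

(* As ln 0 = 0 in the library, log2 0 = 0: the logarithm of a positive
   semidefinite operator is taken on its support, and the convention
   0 log 0 = 0 holds. *)
Definition log2 (x : R) : R := ln x / ln 2.

(* Spectral calculus; meaningful for self-adjoint A, whose eigenvalues are
   real, and then independent of the chosen diagonalization. *)
Definition log2mx n (A : 'M[C]_n) : 'M[C]_n :=
  invmx (spectralmx A) *m
  diag_mx (map_mx (fun z : C => (log2 (complex.Re z))%:C) (spectral_diag A)) *m
  spectralmx A.

(* For density operators the trace below is real, so [Re] is only a cast. *)
Definition relative_entropy n (rho sigma : 'M[C]_n) : \bar R :=
  if `[< op_support rho `<=` op_support sigma >]
  then (complex.Re (\tr (rho *m (log2mx rho - log2mx sigma))))%:E
  else +oo%E.

Definition quantumness n (Gamma L : 'M[C]_n -> 'M[C]_n) : \bar R :=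
  ereal_sup [set relative_entropy (L (Gamma rho)) (Gamma (L rho))
            | rho in @density n].

End Operators.

Arguments density {R n}.

(* Main.v *)
Require Import Defs.
From mathcomp Require Import all_boot all_order all_algebra.
From mathcomp Require Import complex mxtens spectral sesquilinear.
From mathcomp Require Import all_classical all_reals all_analysis.
From mathcomp Require Import ring.

(** Both relative entropies on the right are compared with the one on the left
    state by state: for positive [A], [B] and a pinching [G],
    [S(A || G B) = S(G A || G B) + S(A || G A)].  Indeed [log (G X)] commutes
    with every projector of [G], and [Tr (G A) Y = Tr A Y] for every such [Y],
    so the terms [Tr (G A) log (G A)] and [Tr A log (G A)] cancel.
    As for supports, [ker (G A)] is contained in [ker A], while
    [ker (G B)] is invariant under the projectors, hence it is contained in
    [ker (G A)] as soon as it is contained in [ker A]. *)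

Local Open Scope classical_set_scope.
Local Open Scope ring_scope.

(** * Adjoints, nonnegative forms and spectral calculus *)

Section HermitianForms.
Import Order.TTheory GRing.Theory Num.Theory.
Local Open Scope sesquilinear_scope.
Set Implicit Arguments.
Unset Strict Implicit.
Context {C : numClosedFieldType}.

Lemma trCmx_mul m n p (A : 'M[C]_(m, n)) (B : 'M[C]_(n, p)) :
  (A *m B) ^t* = B ^t* *m A ^t*.
Proof. by rewrite trmx_mul map_mxM. Qed.

Lemma trCmxD m n (A B : 'M[C]_(m, n)) : (A + B) ^t* = A ^t* + B ^t*.
Proof. by rewrite linearD map_mxD. Qed.

Lemma trCmxZ m n (a : C) (A : 'M[C]_(m, n)) : (a *: A) ^t* = a^* *: A ^t*.
Proof. by rewrite linearZ /= map_mxZ. Qed.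

Lemma trCmx_tens m n p q (A : 'M[C]_(m, n)) (B : 'M[C]_(p, q)) :
  (A *t B) ^t* = A ^t* *t B ^t*.
Proof. by rewrite trmx_tens map_mxT. Qed.

Lemma sqnorm_eq0 n (v : 'cV[C]_n) : (v ^t* *m v) 0 0 = 0 -> v = 0.
Proof.
rewrite mxE => /eqP; rewrite psumr_eq0 => [/allP v0|i _]; last first.
  by rewrite !mxE mulrC mul_conjC_ge0.
apply/matrixP => i j; rewrite !mxE (ord1 j).
by have := v0 i (mem_index_enum i); rewrite !mxE mulrC mul_conjC_eq0 => /eqP.
Qed.

Lemma sqnorm_ge0 n (v : 'cV[C]_n) : 0 <= (v ^t* *m v) 0 0.
Proof. by rewrite mxE sumr_ge0 // => i _; rewrite !mxE mulrC mul_conjC_ge0. Qed.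

Lemma formDZ n (A : 'M[C]_n) (u v : 'cV[C]_n) (a : C) :
  ((u + a *: v) ^t* *m A *m (u + a *: v)) 0 0 =
  (u ^t* *m A *m u) 0 0 + a * (u ^t* *m A *m v) 0 0
  + a^* * (v ^t* *m A *m u) 0 0 + a^* * a * (v ^t* *m A *m v) 0 0.
Proof.
rewrite trCmxD trCmxZ !(mulmxDl, mulmxDr) -!(scalemxAl, scalemxAr).
by rewrite !mxE /=; ring.
Qed.

(** Over [R[i]] this unfolds to the same condition as [psd], so the lemmas below apply to [psd]
    matrices directly. *)
Definition nonneg_form n (A : 'M[C]_n) : Prop :=
  forall v : 'cV[C]_n, 0 <= (v ^t* *m A *m v) 0 0.

(** Polarization: write x = <u|A|v> and y = <v|A|u>. The form is real at u + v and at u + i v, which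
    gives x^* + y^* = x + y and x^* - y^* = y - x; add the two. *)
Lemma nonneg_form_conj n (A : 'M[C]_n) (u v : 'cV[C]_n) : nonneg_form A ->
  ((u ^t* *m A *m v) 0 0)^* = (v ^t* *m A *m u) 0 0.
Proof.
move=> posA.
have re (w : 'cV[C]_n) : ((w ^t* *m A *m w) 0 0)^* = (w ^t* *m A *m w) 0 0.
  exact/CrealP/ger0_real/(posA w).
move: (re u) (re v) (re (u + 1 *: v)) (re (u + 'i *: v)).
rewrite (formDZ A u v 1) (formDZ A u v 'i).
move: ((u ^t* *m A *m v) 0 0) ((v ^t* *m A *m u) 0 0) => x y.
move: ((u ^t* *m A *m u) 0 0) ((v ^t* *m A *m v) 0 0) => a b ra rb.
rewrite !(rmorphD, rmorphM) /= !conjCK !conjCi !conjC1 ra rb => e1 e2.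
(* One equation follows from another as soon as [ring] identifies the differences of their sides. *)
have lc (p q r t : C) : r - t = p - q -> p = q -> r = t.
  by move=> + pq; rewrite pq subrr => /subr0_eq.
have {}e1 : x^* + y^* = x + y by apply: lc e1; ring.
have {}e2 : 'i * (x^* - y^*) = 'i * (y - x) by apply: lc (esym e2); ring.
move/(mulfI (neq0Ci _)): e2 => e2.
have two0 : (2 : C) != 0 by rewrite pnatr_eq0.
apply: (mulfI two0); apply: (lc (x^* + y^* + (x^* - y^*)) (x + y + (y - x))).
  by ring.
by rewrite e1 e2.
Qed.

Lemma nonneg_form_hermitian n (A : 'M[C]_n) : nonneg_form A -> A ^t* = A.
Proof.
move=> posA; apply/matrixP => i j.
have entry k l : ((delta_mx k 0 : 'cV_n) ^t* *m A *m (delta_mx l 0 : 'cV_n)) 0 0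
    = A k l.
  by rewrite trmx_delta map_delta_mx -rowE -colE !mxE.
by rewrite !mxE -!entry nonneg_form_conj.
Qed.

Lemma nonneg_form_normal n (A : 'M[C]_n) : nonneg_form A -> A \is normalmx.
Proof. by move=> posA; apply/normalmxP; rewrite nonneg_form_hermitian. Qed.

(* Positivity of the form at [v - t A v] with [t = s / (c + 1)], where
   [s = |A v|^2] and [c = <A v|A|A v>], reads [0 <= t^2 c - 2 t s]. *)
Lemma nonneg_form_eq0 n (A : 'M[C]_n) (v : 'cV[C]_n) : nonneg_form A ->
  (v ^t* *m A *m v) 0 0 = 0 -> A *m v = 0.
Proof.
move=> posA v0; apply: sqnorm_eq0.
set s := (_ 0 0); have s0 : 0 <= s by exact: sqnorm_ge0.
set w := A *m v; set c := (w ^t* *m A *m w) 0 0.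
have c0 : 0 <= c by exact: (posA w).
have wv : (w ^t* *m A *m v) 0 0 = s by rewrite -mulmxA.
have vw : (v ^t* *m A *m w) 0 0 = s.
  by rewrite -nonneg_form_conj // wv; apply/CrealP/ger0_real.
have c1 : 0 < c + 1 by rewrite ltr_wpDl.
have := posA (v + (- (s / (c + 1))) *: w).
rewrite formDZ v0 vw wv -/c.
have -> : (- (s / (c + 1)))^* = - (s / (c + 1)).
  by apply/CrealP; rewrite rpredN; apply/ger0_real/divr_ge0 => //; apply: ltW.
rewrite (_ : _ + _ = - (s ^+ 2 * (c + 2) / (c + 1) ^+ 2)); last first.
  by field; rewrite gt_eqF.
rewrite oppr_ge0 => h; apply/eqP; rewrite -sqrf_eq0 eq_le exprn_ge0 // andbT.
move: h; rewrite pmulr_lle0 ?invr_gt0 ?exprn_gt0 // pmulr_lle0 //.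
by rewrite ltr_wpDl.
Qed.

(** Meant for [A'] the pinching of [A], and for [X], [Y], [Z] the logarithms of [A], of [A'] and of
    the pinched [B]. *)
Lemma mxtrace_telescope n (A A' X Y Z : 'M[C]_n) :
  \tr (A' *m Y) = \tr (A *m Y) -> \tr (A' *m Z) = \tr (A *m Z) ->
  \tr (A *m (X - Z)) = \tr (A' *m (Y - Z)) + \tr (A *m (X - Y)).
Proof.
by move=> AY AZ; rewrite !mulmxBr !raddfB /= AY AZ [RHS]addrC addrA subrK.
Qed.

(** Put Z = U B U^-1. Commuting with diag d means (d_i - d_j) Z_ij = 0, so Z_ij vanishes unless d_i
    = d_j, in which case f d_i = f d_j as well. *)
Lemma diag_conj_comm n (U B : 'M[C]_n) (d : 'rV[C]_n) (f : C -> C) :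
  U \in unitmx ->
  invmx U *m diag_mx d *m U *m B = B *m (invmx U *m diag_mx d *m U) ->
  invmx U *m diag_mx (map_mx f d) *m U *m B =
  B *m (invmx U *m diag_mx (map_mx f d) *m U).
Proof.
move=> uU.
have conjE D : invmx U *m D *m U *m B = B *m (invmx U *m D *m U) <->
    D *m (U *m B *m invmx U) = U *m B *m invmx U *m D.
  split=> [/(congr1 (fun X => U *m X *m invmx U))|
           /(congr1 (fun X => invmx U *m X *m U))].
    by rewrite !mulmxA mulmxV // mul1mx mulmxK.
  by rewrite !mulmxA mulVmx // mul1mx mulmxKV.
move=> /conjE dZ; apply/conjE; apply/matrixP => i j; move/matrixP/(_ i j): dZ.
move: (U *m B *m invmx U) => Z; rewrite !mul_diag_mx !mul_mx_diag !mxE.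
have [<- _|ne] := eqVneq (d 0 i) (d 0 j); first by rewrite mulrC.
rewrite mulrC => /eqP; rewrite -subr_eq0 -mulrBr mulf_eq0 subr_eq0.
by rewrite (negPf ne) orbF => /eqP ->; rewrite mulr0 mul0r.
Qed.

(** The ranks are left free, since a dephasing of one tensor factor alone has projectors such as
    |a><a| tensor 1. *)
Definition projective (I : finType) n (P : I -> 'M[C]_n) : Prop :=
  [/\ forall a, P a ^t* = P a,
      forall a b, P a *m P b = (a == b)%:R *: P a
    & \sum_a P a = 1%:M].

(** * Kronecker products of sums and of projector families *)

Lemma tensmx_sum (I J : finType) m n p q (A : I -> 'M[C]_(m, n))
    (B : J -> 'M[C]_(p, q)) :
  (\sum_a A a) *t (\sum_b B b) = \sum_(ab : I * J) A ab.1 *t B ab.2.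
Proof.
apply/matrixP => i j.
case: (mxtens_indexP i) => i1 i2; case: (mxtens_indexP j) => j1 j2.
rewrite tensmxE !summxE big_distrlr pair_big /=; apply: eq_bigr => ab _.
by rewrite tensmxE.
Qed.

Lemma tensmx_sumr (J : finType) m n p q (A : 'M[C]_(m, n))
    (B : J -> 'M[C]_(p, q)) : A *t (\sum_b B b) = \sum_b A *t B b.
Proof.
apply/matrixP => i j.
case: (mxtens_indexP i) => i1 i2; case: (mxtens_indexP j) => j1 j2.
rewrite tensmxE !summxE mulr_sumr; apply: eq_bigr => b _.
by rewrite tensmxE.
Qed.

Lemma tensmxZr m n p q (A : 'M[C]_(m, n)) (B : 'M[C]_(p, q)) (c : C) :
  A *t (c *: B) = c *: (A *t B).
Proof.
apply/matrixP => i j.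
case: (mxtens_indexP i) => i1 i2; case: (mxtens_indexP j) => j1 j2.
by rewrite tensmxE [in LHS]mxE [RHS]mxE tensmxE mulrCA.
Qed.

Lemma projective_tens (I J : finType) n1 n2 (P : I -> 'M[C]_n1)
    (Q : J -> 'M[C]_n2) : projective P -> projective Q ->
  projective (fun ab : I * J => P ab.1 *t Q ab.2).
Proof.
move=> [Pt PP P1] [Qt QQ Q1]; split=> [a|a b|].
- by rewrite trCmx_tens Pt Qt.
- rewrite tensmx_mul PP QQ -pair_eqE /=.
  case: eqP => _ /=; last by rewrite !scale0r tens0mx.
  by case: eqP => _ /=; rewrite ?scale1r // !scale0r tensmx0.
- rewrite -tensmx_sum P1 Q1; apply/matrixP => i j.
  case: (mxtens_indexP i) => i1 i2; case: (mxtens_indexP j) => j1 j2.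
  by rewrite tensmxE !mxE (can_eq (@mxtens_indexK _ _)) -natrM mulnb.
Qed.

Lemma projective_id n : projective (fun _ : unit => 1%:M : 'M[C]_n).
Proof.
split=> [_|[] []|]; first by rewrite trmx1 map_mx1.
- by rewrite mulmx1 scale1r.
- by rewrite big_const card_unit /= addr0.
Qed.

End HermitianForms.

(** * Supports, logarithms and relative entropy *)

Section Pythagoras.
Import Order.TTheory GRing.Theory Num.Theory.
Local Open Scope sesquilinear_scope.
Set Implicit Arguments.
Unset Strict Implicit.
Context {R : realType}.
Local Notation C := R[i].

(** As [A] is self-adjoint, its range lies in its support. If that support lies in the support of
    [B], each w in ker B is orthogonal to every A u; the choice u = A w yields |A w|^2 = 0. *)
Lemma supportP n (A B : 'M[C]_n) : psd A ->
  (op_support A `<=` op_support B) <->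
  (forall w : 'cV[C]_n, B *m w = 0 -> A *m w = 0).
Proof.
move=> psdA; split=> [AB w Bw|BA v Av w /BA/Av //].
have Aw (u : 'cV[C]_n) : w ^t* *m (A *m u) = 0.
  suff: op_support B (A *m u) by apply.
  apply: AB => z Az.
  rewrite mulmxA -(nonneg_form_hermitian psdA) -trCmx_mul Az.
  by rewrite trmx0 map_mx0 mul0mx.
apply: sqnorm_eq0.
by rewrite trCmx_mul (nonneg_form_hermitian psdA) -mulmxA Aw mxE.
Qed.

Lemma log2mx_comm n (A B : 'M[C]_n) : A \is normalmx -> A *m B = B *m A ->
  log2mx A *m B = B *m log2mx A.
Proof.
move/orthomx_spectralP => /= defA AB; apply: diag_conj_comm.
  exact: spectral_unit.
by rewrite -defA.
Qed.

Lemma relative_entropy_fin n (A B : 'M[C]_n) :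
  op_support A `<=` op_support B ->
  relative_entropy A B = (complex.Re (\tr (A *m (log2mx A - log2mx B))))%:E.
Proof. by move=> AB; rewrite /relative_entropy asboolT. Qed.

Lemma relative_entropy_infty n (A B : 'M[C]_n) :
  ~ (op_support A `<=` op_support B) -> relative_entropy A B = +oo%E.
Proof. by move=> AB; rewrite /relative_entropy asboolF. Qed.

(** * Pinchings by a complete family of orthogonal projectors *)

Section Pinching.
Context {I : finType} {n : nat} {P : I -> 'M[C]_n}.
Hypothesis projP : projective P.

(** By orthogonality both sides reduce to [P a *m X *m P a]. *)
Lemma pinching_comm X a : P a *m pinching P X = pinching P X *m P a.
Proof.
case: projP => _ PP _; rewrite /pinching mulmx_sumr mulmx_suml.
apply: eq_bigr => b _; rewrite -(mulmxA _ (P b)) !mulmxA !PP.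
by case: eqVneq => [->|ab]; rewrite ?scale1r -?mulmxA ?PP ?eqxx ?scale1r //
  eq_sym (negPf ab) !scale0r !mul0mx !mulmx0.
Qed.

Lemma pinching_psd X : psd X -> psd (pinching P X).
Proof.
case: projP => Pt _ _ psdX v.
rewrite /pinching mulmx_sumr mulmx_suml summxE sumr_ge0 // => a _.
have := psdX (P a *m v).
by rewrite trCmx_mul Pt !mulmxA.
Qed.

Lemma tr_pinching X Y : (forall a, P a *m Y = Y *m P a) ->
  \tr (pinching P X *m Y) = \tr (X *m Y).
Proof.
case: projP => _ PP P1 PY; rewrite /pinching mulmx_suml raddf_sum /=.
(* By cyclicity each term is Tr X (P_a Y P_a), and P_a Y P_a = Y P_a because [Y] commutes with the
   idempotent P_a. *)
transitivity (\sum_a \tr (X *m Y *m P a)).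
  apply: eq_bigr => a _.
  rewrite -!mulmxA mxtrace_mulC -!mulmxA -PY (mulmxA (P a) (P a)) PP eqxx.
  by rewrite scale1r PY.
by rewrite -raddf_sum /= -mulmx_sumr P1 mulmx1.
Qed.

(** The form of the pinched matrix at w is the sum of the nonnegative numbers <P_a w|X|P_a w>. All
    of them vanish, hence X P_a w = 0 for every a, and the P_a w add up to w. *)
Lemma pinching_ker X (w : 'cV[C]_n) : psd X -> pinching P X *m w = 0 ->
  X *m w = 0.
Proof.
move=> psdX Xw.
case: (projP) => Pt _ P1.
have: \sum_a ((P a *m w) ^t* *m X *m (P a *m w)) 0 0 = 0.
  transitivity ((w ^t* *m (pinching P X *m w)) 0 0); last first.
    by rewrite Xw mulmx0 mxE.
  rewrite /pinching mulmx_suml mulmx_sumr summxE; apply: eq_bigr => a _.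
  by rewrite trCmx_mul Pt !mulmxA.
move/eqP; rewrite psumr_eq0 => [/allP h|a _]; last exact: (psdX (P a *m w)).
rewrite -[w]mul1mx -P1 mulmx_suml mulmx_sumr big1 // => a _.
by apply: nonneg_form_eq0 => //; apply/eqP/(h a)/mem_index_enum.
Qed.

Lemma pinching_ker_sub X Y :
  (forall w : 'cV[C]_n, pinching P Y *m w = 0 -> X *m w = 0) ->
  forall w : 'cV[C]_n, pinching P Y *m w = 0 -> pinching P X *m w = 0.
Proof.
move=> YX w Yw; rewrite {1}/pinching mulmx_suml big1 // => a _.
rewrite -!mulmxA YX ?mulmx0 //.
by rewrite mulmxA -pinching_comm -mulmxA Yw mulmx0.
Qed.

Lemma log2mx_pinching_comm X a : psd X ->
  P a *m log2mx (pinching P X) = log2mx (pinching P X) *m P a.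
Proof.
move=> psdX; apply/esym/log2mx_comm; last by rewrite pinching_comm.
exact/nonneg_form_normal/pinching_psd.
Qed.

Lemma relative_entropy_pinching A B : psd A -> psd B ->
  relative_entropy A (pinching P B) =
  (relative_entropy (pinching P A) (pinching P B)
   + relative_entropy A (pinching P A))%E.
Proof.
move=> psdA psdB; have psdGA := pinching_psd psdA.
have sAA : op_support A `<=` op_support (pinching P A).
  by apply/(supportP _ psdA) => w; apply: pinching_ker.
rewrite (relative_entropy_fin sAA).
have [sAB|nAB] := pselect (op_support A `<=` op_support (pinching P B)).
  have sGAB : op_support (pinching P A) `<=` op_support (pinching P B).
    apply/(supportP _ psdGA); apply: pinching_ker_sub.
    exact/(supportP _ psdA).
  rewrite !relative_entropy_fin // -EFinD; congr (_ %:E).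
  rewrite -raddfD; congr (complex.Re _).
  by apply: mxtrace_telescope; apply: tr_pinching => a;
    apply: log2mx_pinching_comm.
(* Here both sides are [+oo]: the first summand on the right is infinite too, and the second is
   finite by [sAA]. *)
have nGAB : ~ (op_support (pinching P A) `<=` op_support (pinching P B)).
  by move=> sGAB; apply/nAB/(subset_trans sAA).
by rewrite !relative_entropy_infty.
Qed.

End Pinching.

(** * Every einselection is a pinching *)

Lemma tensor_op_id n1 n2 (X : 'M[C]_(n1 * n2)) : tensor_op id id X = X.
Proof.
apply/matrixP => p q.
case: (mxtens_indexP p) => p1 p2; case: (mxtens_indexP q) => q1 q2.
transitivity (\sum_(i < n1) \sum_(j < n1) \sum_(k < n2) \sum_(l < n2)
    X (mxtens_index (i, k)) (mxtens_index (j, l)) *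
    (((p1 == i) && (q1 == j))%:R * ((p2 == k) && (q2 == l))%:R)).
  do 4 (rewrite summxE; apply: eq_bigr => ? _).
  by rewrite mxE tensmxE !mxE.
(* The four sums collapse one by one to the term i = p1, j = q1, k = p2, l = q2. *)
rewrite (bigD1 p1) //= [X in _ + X]big1 ?addr0; last first.
  move=> i; rewrite eq_sym => /negPf ip.
  by do 3 (rewrite big1 // => ? _); rewrite ip mul0r mulr0.
rewrite (bigD1 q1) //= [X in _ + X]big1 ?addr0; last first.
  move=> i; rewrite eq_sym => /negPf ip.
  by do 2 (rewrite big1 // => ? _); rewrite ip andbF mul0r mulr0.
rewrite (bigD1 p2) //= [X in _ + X]big1 ?addr0; last first.
  move=> i; rewrite eq_sym => /negPf ip.
  by rewrite big1 // => ? _; rewrite ip mulr0 mulr0.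
rewrite (bigD1 q2) //= [X in _ + X]big1 ?addr0; last first.
  by move=> i; rewrite eq_sym => /negPf ip; rewrite ip andbF mulr0 mulr0.
by rewrite !eqxx !mulr1.
Qed.

Lemma pinching_sum (I J : finType) n (P : I -> 'M[C]_n) (F : J -> 'M[C]_n) :
  pinching P (\sum_j F j) = \sum_j pinching P (F j).
Proof.
rewrite /pinching exchange_big; apply: eq_bigr => a _.
by rewrite mulmx_sumr mulmx_suml.
Qed.

Lemma pinchingZ (I : finType) n (P : I -> 'M[C]_n) (c : C) X :
  pinching P (c *: X) = c *: pinching P X.
Proof.
rewrite /pinching scaler_sumr; apply: eq_bigr => a _.
by rewrite -scalemxAr -scalemxAl.
Qed.

(** By [tensor_op_id], [X] is a combination of products of matrix units; by linearity it suffices to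
    compare both maps on these, where the mixed-product rule applies. *)
Lemma tensor_op_pinching (I J : finType) n1 n2 (P : I -> 'M[C]_n1)
    (Q : J -> 'M[C]_n2) :
  tensor_op (pinching P) (pinching Q) =
  pinching (fun ab : I * J => P ab.1 *t Q ab.2).
Proof.
apply/funext => X; rewrite -[in RHS](tensor_op_id X) /tensor_op.
do 4 (rewrite pinching_sum; apply: eq_bigr => ? _).
rewrite pinchingZ; congr (_ *: _); rewrite tensmx_sum.
by apply: eq_bigr => ab _; rewrite !tensmx_mul.
Qed.

Lemma projective_dephasing n (e : 'I_n -> 'cV[C]_n) : orthonormal_basis e ->
  projective (fun a => e a *m (e a) ^t*).
Proof.
move=> eP; split=> [a|a b|].
- by rewrite trCmx_mul trmxCK.
- rewrite !mulmxA -(mulmxA (e a)) eP; case: eqP => [->|_].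
    by rewrite mulmx1 scale1r.
  by rewrite raddf0 mulmx0 mul0mx scale0r.
(* The columns of [U] are the basis vectors. Orthonormality says U^* U = 1; as [U] is square, U U^*
   = 1, which is completeness. *)
- pose U := \matrix_(i, j) e j i 0.
  have: U ^t* *m U = 1%:M.
    apply/matrixP => i j; have /matrixP/(_ 0 0) := eP i j; rewrite !mxE mulr1n.
    by move=> <-; apply: eq_bigr => k _; rewrite !mxE.
  move/mulmx1C => <-; apply/matrixP => i j; rewrite summxE mxE.
  by apply: eq_bigr => k _; rewrite !mxE big_ord1 !mxE.
Qed.

(** Brings the dephasings of a single factor under [tensor_op_pinching]. *)
Lemma pinching_id n : pinching (fun _ : unit => 1%:M : 'M[C]_n) = id.
Proof.
apply/funext => X.
by rewrite /pinching big_const card_unit /= addr0 mul1mx mulmx1.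
Qed.

Lemma einselection_pinching n (G : 'M[C]_n -> 'M[C]_n) : einselection G ->
  exists (I : finType) (P : I -> 'M[C]_n), projective P /\ G = pinching P.
Proof.
case=> {n G} n.
- by move=> e eP; do 2 eexists; split; first exact: projective_dephasing eP.
- move=> n2 e1 e2 e1P e2P; rewrite /dephasing tensor_op_pinching.
  do 2 eexists; split; last by [].
  exact: projective_tens (projective_dephasing e1P) (projective_dephasing e2P).
- move=> n2 e eP; rewrite /dephasing -pinching_id tensor_op_pinching.
  do 2 eexists; split; last by [].
  exact: projective_tens (projective_dephasing eP) (projective_id _).
- move=> n2 e eP; rewrite /dephasing -pinching_id tensor_op_pinching.
  do 2 eexists; split; last by [].
  exact: projective_tens (projective_id _) (projective_dephasing eP).
Qed.

(** * From complete positivity to positivity *)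

Lemma psd_castmx m n (e : m = n) (X : 'M[C]_m) :
  psd (castmx (e, e) X) <-> psd X.
Proof. by case: n / e; rewrite castmx_id. Qed.

Lemma psd_tens1mx n (X : 'M[C]_n) : psd ((1%:M : 'M[C]_1) *t X) <-> psd X.
Proof. by rewrite tens_scalar1mx; apply: psd_castmx. Qed.

(** Complete positivity is used with an ancilla of dimension 1: expanding [X] in matrix units shows
    that [tensor_op id L] sends 1 tensor X to 1 tensor L X. *)
Lemma completely_positive_psd n (L : {linear 'M[C]_n -> 'M[C]_n}) X :
  completely_positive L -> psd X -> psd (L X).
Proof.
move=> cpL /psd_tens1mx/cpL LX; apply/psd_tens1mx.
congr (psd _): LX.
rewrite /tensor_op !big_ord1 [in RHS](matrix_sum_delta X).
rewrite linear_sum tensmx_sumr.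
apply: eq_bigr => k _; rewrite linear_sum tensmx_sumr; apply: eq_bigr => l _.
rewrite tensmxE mxE mul1r linearZ tensmxZr /=; congr (_ *: (_ *t _)).
by apply/matrixP => i j; rewrite !ord1 !mxE.
Qed.

End Pythagoras.

Theorem theorem6p1 (R : realType) (n : nat)
    (Lambda : {linear 'M[R[i]]_n -> 'M[R[i]]_n})
    (Gamma : 'M[R[i]]_n -> 'M[R[i]]_n)
    (hLambda : quantum_operation Lambda) (hGamma : einselection Gamma) :
  quantumness Gamma Lambda =
  ereal_sup [set (relative_entropy (Gamma (Lambda (Gamma rho)))
                                   (Gamma (Lambda rho))
                  + relative_entropy (Lambda (Gamma rho))
                                     (Gamma (Lambda (Gamma rho))))%E
            | rho in density].
Proof.
have [I [P [projP ->]]] := einselection_pinching hGamma.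
case: hLambda => cpL _; congr ereal_sup; apply: eq_imagel => rho [psdrho _].
exact: (relative_entropy_pinching projP
  (completely_positive_psd cpL (pinching_psd projP psdrho))
  (completely_positive_psd cpL psdrho)).
Qed.
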